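(* Let $C$ be a coalgebra and $A$ an algebra over a field $\mathbb{K}$, and let $f,g:C\to A$ be convolution idempotent maps. Then the following are equivalent: (a) $f=g$. (b) $f(c_1)g(c_2)=g(c_1)f(c_2)=g(c)$ for all $c\in C$, and $f(x)=g(x)$ for all $x\in C_0$, where $C_0$ is the coradical of $C$.
   Context: Sweedler notation $\Delta(c)=c_1\otimes c_2$ is used. A linear map $f:C\to A$ is a convolution idempotent map if it is an idempotent of the convolution algebra $\mathrm{Hom}_{\mathbb{K}}(C,A)$, i.e. $f(c)=f(c_1)f(c_2)$ for all $c\in C$. The coradical $C_0$ of $C$ is the sum of all simple subcoalgebras of $C$. *)

(* Defs.v *)
From HB Require Import structures.
From mathcomp Require Import all_boot all_order all_algebra.
From mathcomp Require Import boolp classical_sets.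

Set Implicit Arguments.
Unset Strict Implicit.
Unset Printing Implicit Defensive.

Import GRing.Theory.

Local Open Scope ring_scope.
Local Open Scope classical_set_scope.
Local Open Scope quotient_scope.

(* Tensor product of two vector spaces: formal finite sums of pairs, written  *)
(* as sequences, modulo the congruence generated by the bilinearity relations.*)
(* The universal property is given by tensE, tensor_lift_is_linear,           *)
(* tensor_lift_tens and tensor_lift_uniq below.                               *)
Section TensorProduct.
Variables (K : fieldType) (U V : lmodType K).

Inductive tensor_rel : seq (U * V) -> seq (U * V) -> Prop :=
| TensorRefl s : tensor_rel s s
| TensorSym s t : tensor_rel s t -> tensor_rel t s
| TensorTrans s t r : tensor_rel s t -> tensor_rel t r -> tensor_rel s r
| TensorCat s s' t t' :
    tensor_rel s s' -> tensor_rel t t' -> tensor_rel (s ++ t) (s' ++ t')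
| TensorComm s t : tensor_rel (s ++ t) (t ++ s)
| TensorDl u u' v : tensor_rel [:: (u + u', v)] [:: (u, v); (u', v)]
| TensorDr u v v' : tensor_rel [:: (u, v + v')] [:: (u, v); (u, v')]
| TensorZ a u v : tensor_rel [:: (a *: u, v)] [:: (u, a *: v)]
| Tensor0 v : tensor_rel [:: (0, v)] [::].

Definition tensor_relb (s t : seq (U * V)) : bool := `[< tensor_rel s t >].

Lemma tensor_relb_equiv : equiv_class_of tensor_relb.
Proof.
split=> [s|s t|t s r].
- by apply/asboolP; apply: TensorRefl.
- by apply/asboolP/asboolP; apply: TensorSym.
- by move=> /asboolP ts /asboolP sr; apply/asboolP; apply: TensorTrans sr.
Qed.

Canonical tensor_relb_equiv_rel := EquivRelPack tensor_relb_equiv.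
Canonical tensor_relb_encModRel := defaultEncModRel tensor_relb.

Definition tensor := {eq_quot tensor_relb}.

HB.instance Definition _ := Choice.on tensor.
HB.instance Definition _ : EqQuotient _ tensor_relb tensor := EqQuotient.on tensor.

Lemma tensor_eqP (s t : seq (U * V)) :
  (\pi_tensor s = \pi_tensor t) <-> tensor_rel s t.
Proof. by split=> [/eqmodP/asboolP|st]; last by apply/eqmodP/asboolP. Qed.

Lemma tensor_reprP (s : seq (U * V)) : tensor_rel (repr (\pi_tensor s)) s.
Proof. by apply/tensor_eqP; rewrite reprK. Qed.

Definition tensor_scale_seq (a : K) (s : seq (U * V)) :=
  [seq (a *: p.1, p.2) | p <- s].

Definition tensor_zero : tensor := \pi_tensor [::].
Definition tensor_add (x y : tensor) : tensor := \pi_tensor (repr x ++ repr y).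
Definition tensor_scale (a : K) (x : tensor) : tensor :=
  \pi_tensor (tensor_scale_seq a (repr x)).
Definition tensor_opp (x : tensor) : tensor := tensor_scale (-1) x.

Lemma tensor_rel_cons p s t : tensor_rel s t -> tensor_rel (p :: s) (p :: t).
Proof. by move=> st; apply: (TensorCat (TensorRefl [:: p]) st). Qed.

Lemma tensor_rel0r u : tensor_rel [:: (u, 0)] [::].
Proof.
apply: TensorTrans (Tensor0 0); apply: TensorSym.
by have := TensorZ 0 u 0; rewrite scale0r scaler0.
Qed.

Lemma tensor_rel_scale a s t :
  tensor_rel s t -> tensor_rel (tensor_scale_seq a s) (tensor_scale_seq a t).
Proof.
elim=> {s t} /=.
- by move=> s; apply: TensorRefl.
- by move=> s t _; apply: TensorSym.
- by move=> s t r _ st _; apply: TensorTrans.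
- move=> s s' t t' _ ss' _ tt'; rewrite /tensor_scale_seq !map_cat.
  exact: TensorCat.
- by move=> s t; rewrite /tensor_scale_seq !map_cat; apply: TensorComm.
- by move=> u u' v; rewrite scalerDr; apply: TensorDl.
- by move=> u v v'; apply: TensorDr.
- by move=> b u v; rewrite scalerA mulrC -scalerA; apply: TensorZ.
- by move=> v; rewrite scaler0; apply: Tensor0.
Qed.

Lemma pi_tensor_add s t :
  tensor_add (\pi_tensor s) (\pi_tensor t) = \pi_tensor (s ++ t).
Proof. by apply/tensor_eqP; apply: TensorCat; apply: tensor_reprP. Qed.

Lemma pi_tensor_scale a s :
  tensor_scale a (\pi_tensor s) = \pi_tensor (tensor_scale_seq a s).
Proof. by apply/tensor_eqP; apply: tensor_rel_scale; apply: tensor_reprP. Qed.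

Lemma tensor_addA : associative tensor_add.
Proof.
elim/quotW=> s; elim/quotW=> t; elim/quotW=> r.
by rewrite (pi_tensor_add t) (pi_tensor_add s) (pi_tensor_add s) pi_tensor_add catA.
Qed.

Lemma tensor_addC : commutative tensor_add.
Proof.
elim/quotW=> s; elim/quotW=> t.
rewrite (pi_tensor_add s) (pi_tensor_add t); apply/tensor_eqP.
exact: TensorComm.
Qed.

Lemma tensor_add0 : left_id tensor_zero tensor_add.
Proof. by elim/quotW=> s; rewrite (pi_tensor_add [::]). Qed.

Lemma tensor_rel_scaleDl a b s :
  tensor_rel (tensor_scale_seq (a + b) s)
             (tensor_scale_seq a s ++ tensor_scale_seq b s).
Proof.
elim: s => [|[u v] s IHs] /=; first exact: TensorRefl.
rewrite scalerDl; apply: TensorTrans (TensorCat (TensorDl _ _ _) IHs) _ => /=.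
apply: tensor_rel_cons.
rewrite -cat1s !catA -[_ :: tensor_scale_seq b s]cat1s catA.
by apply: TensorCat; [apply: TensorComm|apply: TensorRefl].
Qed.

Lemma tensor_rel_scale0 s : tensor_rel (tensor_scale_seq 0 s) [::].
Proof.
elim: s => [|[u v] s IHs] /=; first exact: TensorRefl.
by rewrite scale0r; apply: (TensorCat (Tensor0 v) IHs).
Qed.

Lemma tensor_scale1 : left_id 1 tensor_scale.
Proof.
elim/quotW=> s; rewrite pi_tensor_scale; congr (\pi_tensor _).
by rewrite -[RHS]map_id; apply: eq_map => -[u v]; rewrite scale1r.
Qed.

Lemma tensor_scaleDl x : {morph tensor_scale^~ x : a b / a + b >-> tensor_add a b}.
Proof.
elim/quotW: x => s a b /=.
rewrite !pi_tensor_scale (pi_tensor_add (tensor_scale_seq a s)).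
by apply/tensor_eqP; apply: tensor_rel_scaleDl.
Qed.

Lemma tensor_addN : left_inverse tensor_zero tensor_opp tensor_add.
Proof.
elim/quotW=> s; rewrite /tensor_opp -{2}[\pi s]tensor_scale1 -tensor_scaleDl addNr.
by rewrite pi_tensor_scale; apply/tensor_eqP; apply: tensor_rel_scale0.
Qed.

HB.instance Definition _ :=
  GRing.isZmodule.Build tensor tensor_addA tensor_addC tensor_add0 tensor_addN.

Lemma tensor_scaleA a b x :
  tensor_scale a (tensor_scale b x) = tensor_scale (a * b) x.
Proof.
elim/quotW: x => s.
rewrite (pi_tensor_scale b) (pi_tensor_scale a) pi_tensor_scale.
congr (\pi_tensor _).
by rewrite /tensor_scale_seq -map_comp; apply: eq_map => -[u v] /=; rewrite scalerA.
Qed.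

Lemma tensor_scaleDr : right_distributive tensor_scale +%R.
Proof.
move=> a; elim/quotW=> s; elim/quotW=> t.
rewrite [_ + _ in LHS]pi_tensor_add (pi_tensor_scale a (s ++ t)).
rewrite (pi_tensor_scale a s) (pi_tensor_scale a t) [RHS]pi_tensor_add.
by rewrite /tensor_scale_seq map_cat.
Qed.

HB.instance Definition _ :=
  GRing.Zmodule_isLmodule.Build K tensor
    tensor_scaleA tensor_scale1 tensor_scaleDr tensor_scaleDl.

Definition tens (u : U) (v : V) : tensor := \pi_tensor [:: (u, v)].

Lemma tensDl u u' v : tens (u + u') v = tens u v + tens u' v.
Proof. by rewrite [RHS]pi_tensor_add; apply/tensor_eqP; apply: TensorDl. Qed.

Lemma tensDr u v v' : tens u (v + v') = tens u v + tens u v'.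
Proof. by rewrite [RHS]pi_tensor_add; apply/tensor_eqP; apply: TensorDr. Qed.

Lemma tensZl a u v : tens (a *: u) v = a *: tens u v.
Proof. by rewrite [RHS]pi_tensor_scale. Qed.

Lemma tensZr a u v : tens u (a *: v) = a *: tens u v.
Proof.
by rewrite -tensZl; apply/tensor_eqP; apply: TensorSym; apply: TensorZ.
Qed.

Lemma pi_tensorE s : \pi_tensor s = \sum_(p <- s) tens p.1 p.2.
Proof.
elim: s => [|[u v] s IHs]; first by rewrite big_nil.
by rewrite big_cons -IHs [RHS]pi_tensor_add.
Qed.

Lemma tensE (t : tensor) : t = \sum_(p <- repr t) tens p.1 p.2.
Proof. by rewrite -pi_tensorE reprK. Qed.

(* The linear map induced by b; meaningful only for bilinear b, for which     *)
(* tensor_lift b (\sum_i tens u_i v_i) = \sum_i b u_i v_i. In Sweedler        *)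
(* notation, tensor_lift b (comul c) is b c_1 c_2.                            *)
Definition tensor_lift (W : lmodType K) (b : U -> V -> W) (t : tensor) : W :=
  \sum_(p <- repr t) b p.1 p.2.

Section Universal.
Variables (W : lmodType K) (b : U -> V -> W).
Hypothesis b_linl : forall v, linear (b^~ v).
Hypothesis b_linr : forall u, linear (b u).

Let b0l v : b 0 v = 0.
Proof. by have := b_linl v (-1) 0 0; rewrite scaler0 addr0 scaleN1r addNr. Qed.

Let b0r u : b u 0 = 0.
Proof. by have := b_linr u (-1) 0 0; rewrite scaler0 addr0 scaleN1r addNr. Qed.

Let bDl u u' v : b (u + u') v = b u v + b u' v.
Proof. by have := b_linl v 1 u u'; rewrite !scale1r. Qed.

Let bDr u v v' : b u (v + v') = b u v + b u v'.
Proof. by have := b_linr u 1 v v'; rewrite !scale1r. Qed.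

Let bZl a u v : b (a *: u) v = a *: b u v.
Proof. by have := b_linl v a u 0; rewrite b0l !addr0. Qed.

Let bZr a u v : b u (a *: v) = a *: b u v.
Proof. by have := b_linr u a v 0; rewrite b0r !addr0. Qed.

Lemma tensor_lift_pi s : tensor_lift b (\pi_tensor s) = \sum_(p <- s) b p.1 p.2.
Proof.
suff sum_rel r t : tensor_rel r t ->
    \sum_(p <- r) b p.1 p.2 = \sum_(p <- t) b p.1 p.2.
  by apply: sum_rel; apply: tensor_reprP.
elim=> {s r t} //=.
- by move=> s t r _ -> _ ->.
- by move=> s s' t t' _ ss' _ tt'; rewrite !big_cat ss' tt'.
- by move=> s t; rewrite !big_cat /= addrC.
- by move=> u u' v; rewrite !big_cons !big_nil !addr0 bDl.
- by move=> u v v'; rewrite !big_cons !big_nil !addr0 bDr.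
- by move=> a u v; rewrite !big_seq1 bZl bZr.
- by move=> v; rewrite big_seq1 big_nil b0l.
Qed.

Lemma tensor_lift_tens u v : tensor_lift b (tens u v) = b u v.
Proof. by rewrite tensor_lift_pi big_seq1. Qed.

Lemma tensor_lift_is_linear : linear (tensor_lift b).
Proof.
move=> a; elim/quotW=> s; elim/quotW=> t.
rewrite [a *: _ in LHS]pi_tensor_scale [_ + _ in LHS]pi_tensor_add !tensor_lift_pi.
rewrite big_cat /= big_map scaler_sumr; congr (_ + _).
apply: eq_bigr => -[u v] _ /=.
by rewrite bZl.
Qed.

Lemma tensor_lift_uniq (h : {linear tensor -> W}) :
  (forall u v, h (tens u v) = b u v) -> h =1 tensor_lift b.
Proof.
move=> hb t; rewrite {1}[t]tensE linear_sum.
by apply: eq_bigr => p _; apply: hb.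
Qed.

End Universal.
End TensorProduct.

Definition tensor_map (K : fieldType) (U V U' V' : lmodType K)
    (f : U -> U') (g : V -> V') : tensor U V -> tensor U' V' :=
  tensor_lift (fun u v => tens (f u) (g v)).

Definition tensor_assoc (K : fieldType) (U V W : lmodType K) :
    tensor (tensor U V) W -> tensor U (tensor V W) :=
  tensor_lift (fun t w => tensor_lift (fun u v => tens u (tens v w)) t).

HB.mixin Record Lmodule_isCoalgebra (K : fieldType) C of GRing.Lmodule K C := {
  comul : {linear C -> tensor C C};
  counit : {linear C -> K^o};
  comulA : forall c : C,
    tensor_assoc (tensor_map comul idfun (comul c))
      = tensor_map idfun comul (comul c);
  counit_comull : forall c : C,
    tensor_lift (fun x y : C => counit x *: y) (comul c) = c;
  counit_comulr : forall c : C,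
    tensor_lift (fun x y : C => counit y *: x) (comul c) = c
}.

#[short(type="coalgType")]
HB.structure Definition Coalgebra (K : fieldType) :=
  {C of GRing.Lmodule K C & Lmodule_isCoalgebra K C}.

(* algType K : unital associative algebras, with 1 != 0 as a library-wide     *)
(* convention; for the zero algebra the convolution algebra is zero.          *)
Section Convolution.
Variables (K : fieldType) (C : coalgType K) (A : algType K).

Definition conv (f g : {linear C -> A}) (c : C) : A :=
  tensor_lift (fun x y : C => f x * g y) (comul c).

Definition conv_idempotent (f : {linear C -> A}) : Prop :=
  forall c, f c = conv f f c.

End Convolution.

Section Coradical.
Variables (K : fieldType) (C : coalgType K).

(* The image of D (x) D in C (x) C. *)
Definition tensor_square (D : set C) : set (tensor C C) :=
  [set t | exists2 s : seq (C * C),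
     (forall p, p \in s -> D p.1 /\ D p.2) & t = \sum_(p <- s) tens p.1 p.2].

Definition subcoalgebra (D : set C) : Prop :=
  submod_closed (mem D) /\ forall d, D d -> tensor_square D (comul d).

Definition simple_subcoalgebra (D : set C) : Prop :=
  [/\ subcoalgebra D, D <> [set 0]
    & forall E : set C, subcoalgebra E -> E `<=` D -> E = [set 0] \/ E = D].

Definition coradical : set C :=
  [set x | exists2 s : seq C,
     (forall y, y \in s -> exists2 D, simple_subcoalgebra D & D y)
     & x = \sum_(y <- s) y].

End Coradical.

Arguments coradical {K} C.

(* Main.v *)
Require Import Defs.
From HB Require Import structures.
From mathcomp Require Import all_boot all_order all_algebra.
From mathcomp Require Import boolp classical_sets.

Import GRing.Theory.

Set Implicit Arguments.
Unset Strict Implicit.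
Unset Printing Implicit Defensive.

Local Open Scope ring_scope.

(** The convolution identities say exactly what is needed for [h = f - g] to be
    a convolution idempotent, and [h] is zero on the coradical; so the point is
    that an idempotent [h] with this property is zero ([idempotent_zero]).

    In a filtration of [C] by powers of the coradical, [h = h * h * ... * h]
    would be zero on each step.  The argument below replaces this filtration by
    one step of it.  The dual algebra [C^*] acts on both sides of [C].  Let [V]
    be the largest left [C^*]-submodule of [C] on which [h] is zero.  If [V] is
    not [C], local finiteness gives a [c] outside [V] for which the module
    [(C^* c + V) / V] is simple ([idempotent_zero_of_finite]).  The coefficients
    [psi(x_1) x_2], for [x] in [C^* c] and [psi] a functional that is zero on
    [V], form a simple subcoalgebra or zero ([coefficients_coradical]), so [h]
    is zero on them.  This says that [x_1 (x) h(x_2)] is in [V (x) A], and then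
    [h x = h(x_1) h(x_2)] is zero because [h] is zero on [V]
    ([idempotent_zero_on_simple]): so [c] is in [V], a contradiction.

    Simplicity of the coefficient coalgebra is the finite-dimensional statement
    that the image of an algebra in the endomorphisms of a simple module is a
    simple algebra.  It is obtained here without structure theory, from the
    observation that an ideal acting nontrivially on a simple module contains,
    for each finite set of vectors, an element that fixes them
    ([coefficients_unit]).

    Linear algebra in infinite dimension enters through
    [separating_functional], a consequence of Zorn's lemma, and through
    [tensor_slice], which locates a tensor by applying functionals to one
    side. *)

(** * Subspaces and separation by functionals *)

Section Subspaces.
Context {K : fieldType} {U : lmodType K}.
Implicit Types (V W S : set U) (x y : U).

Definition subspace W :=
  W 0 /\ forall (a : K) x y, W x -> W y -> W (a *: x + y).

Lemma subspaceP W : subspace W <-> submod_closed (mem W).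
Proof.
split=> -[W0 WD]; split; rewrite ?inE //.
- by move=> a x y; rewrite !inE; apply: WD.
- by move: W0; rewrite inE.
- move=> a x y Wx Wy; have := WD a x y; rewrite !inE; exact.
Qed.

Section Closure.
Variables (W : set U) (subW : subspace W).

Lemma subspace0 : W 0.
Proof. by case: subW. Qed.

Lemma subspaceD x y : W x -> W y -> W (x + y).
Proof. by move=> Wx Wy; rewrite -[x]scale1r; apply: (proj2 subW). Qed.

Lemma subspaceZ a x : W x -> W (a *: x).
Proof.
by move=> Wx; rewrite -[_ *: _]addr0; apply: (proj2 subW) => //; case: subW.
Qed.

Lemma subspaceB x y : W x -> W y -> W (x - y).
Proof.
by move=> Wx Wy; rewrite -scaleN1r addrC; apply: (proj2 subW).
Qed.

Lemma subspace_sum (I : eqType) (r : seq I) (F : I -> U) :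
  (forall i, i \in r -> W (F i)) -> W (\sum_(i <- r) F i).
Proof.
move=> WF; rewrite big_seq; apply: (big_ind W) => //.
- exact: subspace0.
- exact: subspaceD.
Qed.

End Closure.

Lemma subspace_zero : subspace [set 0 : U].
Proof. by split=> // a x y /= -> ->; rewrite scaler0 addr0. Qed.

(** As an intersection, so that a property of the span is proved by checking
    that it defines a subspace containing the generators. *)
Definition lin_span S : set U :=
  fun x => forall W, subspace W -> (S `<=` W)%classic -> W x.

Lemma lin_span_subspace S : subspace (lin_span S).
Proof.
split=> [W subW _|a x y Sx Sy W subW SW]; first exact: subspace0.
by apply: (proj2 subW); [apply: Sx|apply: Sy].
Qed.

Lemma sub_lin_span S x : S x -> lin_span S x.
Proof. by move=> Sx W _; apply. Qed.

(** Zorn's lemma gives a subspace [M] that contains [W] and is maximal for not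
    containing [v].  Every vector is then congruent mod [M] to a unique multiple
    of [v], and the coefficient is the functional. *)
Lemma separating_functional W v : subspace W -> ~ W v ->
  exists2 phi : {linear U -> K^o}, forall w, W w -> phi w = 0 & phi v = 1.
Proof.
move=> subW Wv.
(* The union with [W] makes the empty chain admissible. *)
pose P X := subspace (X `|` W)%classic /\ ~ (X `|` W)%classic v.
have chainP F : (F `<=` P)%classic -> total_on F subset ->
    P (\bigcup_(X in F) X)%classic.
  move=> FP totF; split; last first.
    by case=> [[X FX Xv]|//]; case: (FP _ FX) => _; apply; left.
  split=> [|a x y]; first by right; apply: subspace0.
  have inX X : F X -> (X `|` W)%classic (a *: x + y) ->
      (\bigcup_(X in F) X `|` W)%classic (a *: x + y).
    by move=> FX [?|?]; [left; exists X|right].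
  case=> [[X FX Xx]|Wx] [[Y FY Yy]|Wy].
  - case: (totF _ _ FX FY) => XY.
    + by apply: (inX Y FY); apply: (proj2 (proj1 (FP _ FY))); left=> //;
        apply: XY.
    + by apply: (inX X FX); apply: (proj2 (proj1 (FP _ FX))); left=> //;
        apply: XY.
  - by apply: (inX X FX); apply: (proj2 (proj1 (FP _ FX))); [left|right].
  - by apply: (inX Y FY); apply: (proj2 (proj1 (FP _ FY))); [right|left].
  - by right; apply: (proj2 subW).
have [X [[subM Mv] maxX]] := Zorn_bigcup chainP.
set M := (X `|` W)%classic in subM Mv.
have coefP x : exists k : K, M (x - k *: v).
  have [Mx|Mx] := pselect (M x); first by exists 0; rewrite scale0r subr0.
  pose B : set U := fun y => exists k : K, M (y - k *: x).
  have subB : subspace B.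
    split=> [|a y z [k My] [l Mz]].
      by exists 0; rewrite scale0r subr0; apply: subspace0.
    exists (a * k + l); rewrite scalerDl -scalerA opprD addrACA -scalerBr.
    exact: (proj2 subM).
  have MB y : M y -> B y by move=> My; exists 0; rewrite scale0r subr0.
  have Bx : B x by exists 1; rewrite scale1r subrr; apply: subspace0.
  have [[k Mvk]|Bv] := pselect (B v); last first.
    case: (maxX B).
      split; first by move=> y Xy; apply: MB; left.
      by move=> BX; apply: Mx; left; apply: BX.
    have BW : (B `|` W = B)%classic.
      by apply/seteqP; split=> y; [case=> // Wy; apply: MB; right|left].
    by split; rewrite BW.
  have k0 : k != 0.
    by apply/eqP => k0; apply: Mv; move: Mvk; rewrite k0 scale0r subr0.
  exists k^-1; have := subspaceZ subM (- k^-1) Mvk.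
  by rewrite scalerBr scalerA mulNr mulVf // !scaleNr scale1r opprK addrC.
pose phi (x : U) : K^o := projT1 (cid (coefP x)).
have phiP x : M (x - phi x *: v) by rewrite /phi; case: cid.
have phiU x k : M (x - k *: v) -> phi x = k.
  move=> Mk; have := subspaceB subM (phiP x) Mk.
  rewrite opprB addrC addrA subrK -scalerBl => Md.
  apply/eqP; rewrite eq_sym -subr_eq0; apply/eqP; apply: contrapT => /eqP d0.
  apply: Mv; have := subspaceZ subM (k - phi x)^-1 Md.
  by rewrite scalerA mulVf // scale1r.
have phi_lin : linear phi.
  move=> a x y; apply: phiU; rewrite scalerDl -scalerA opprD addrACA -scalerBr.
  by apply: (proj2 subM); apply: phiP.
pose mphi := GRing.isLinear.Build K U K^o _ phi phi_lin.
exists (HB.pack phi mphi : {linear U -> K^o}) => [w Ww|] /=; apply: phiU.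
  by rewrite scale0r subr0; right.
by rewrite scale1r subrr; apply: subspace0.
Qed.

Lemma subspace_by_functionals W x : subspace W ->
  (forall phi : {linear U -> K^o}, (forall w, W w -> phi w = 0) -> phi x = 0) ->
  W x.
Proof.
move=> subW ker; apply: contrapT => Wx.
have [phi phiW phix] := separating_functional subW Wx.
by move: (ker phi phiW); rewrite phix => /eqP; rewrite oner_eq0.
Qed.

Lemma functionals_separate x y :
  (forall phi : {linear U -> K^o}, phi x = phi y) -> x = y.
Proof.
move=> xy; apply/eqP; rewrite -subr_eq0; apply/eqP.
apply: (subspace_by_functionals subspace_zero) => phi _.
by rewrite linearB /= xy subrr.
Qed.

(** * Subspaces spanned by a list modulo a subspace *)

(** The subspace [V + span s].  The size of [s] bounds the dimension modulo
    [V], and the recursion on [s] allows induction on this bound. *)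
Fixpoint span_mod V (s : seq U) (y : U) : Prop :=
  if s is x :: s' then exists k : K, span_mod V s' (y - k *: x) else V y.

Lemma span_mod_subspace V s : subspace V -> subspace (span_mod V s).
Proof.
move=> subV; elim: s => [//|x s IH]; split=> [|a y z /= [k Hy] [l Hz]] /=.
  by exists 0; rewrite scale0r subr0; apply: subspace0.
exists (a * k + l); rewrite scalerDl -scalerA opprD addrACA -scalerBr.
exact: (proj2 IH).
Qed.

Lemma span_mod_sub V s y : subspace V -> V y -> span_mod V s y.
Proof.
move=> subV Vy; elim: s => [//|x s IH] /=; exists 0.
by rewrite scale0r subr0.
Qed.

Lemma span_mod_mem V s y : subspace V -> y \in s -> span_mod V s y.
Proof.
move=> subV; elim: s => [//|x s IH]; rewrite inE /=.
case: eqVneq => [->|_] /= ys.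
  exists 1; rewrite scale1r subrr.
  by apply: subspace0; apply: span_mod_subspace.
by exists 0; rewrite scale0r subr0; apply: IH.
Qed.

Lemma functionalB (phi : {linear U -> K^o}) x k y :
  phi (x - k *: y) = phi x - k * phi y.
Proof. by rewrite linearB [phi (k *: y)]linearZ. Qed.

(** For nonzero [phi x], the map [y - (phi y / phi x) *: x] is the projection
    along [x] onto the hyperplane [phi = 0]. *)
Lemma span_mod_project V (phi : {linear U -> K^o}) x s y :
  (forall v, V v -> phi v = 0) -> span_mod V s y ->
  span_mod V [seq u - (phi u / phi x) *: x | u <- s] (y - (phi y / phi x) *: x).
Proof.
move=> phiV; elim: s y => [|u s IH] y /=.
  by move=> Vy; rewrite phiV // mul0r scale0r subr0.
case=> k /IH; rewrite functionalB => Hk; exists k.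
move: Hk; congr (span_mod _ _ _).
rewrite mulrBl scalerBl scalerBr scalerA mulrA !opprB addrACA [RHS]addrACA.
by rewrite [- (k *: u) + _]addrC.
Qed.

(** Some generator lies off the hyperplane [phi = 0]: drop it and project along
    it the generators that follow it.  Those that precede it are already in the
    hyperplane. *)
Lemma span_mod_hyperplane V (phi : {linear U -> K^o}) s c :
    (forall v, V v -> phi v = 0) -> span_mod V s c -> phi c != 0 ->
  exists2 s' : seq U, (size s' < size s)%N &
    forall y, span_mod V s y -> phi y = 0 -> span_mod V s' y.
Proof.
move=> phiV; elim: s c => [|x s IH] c /=.
  by move=> Vc; rewrite phiV // eqxx.
case=> k Hc phic; have [phix|phix] := eqVneq (phi x) 0.
  have [|s' ss' Hs'] := IH _ Hc; first by rewrite functionalB phix mulr0 subr0.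
  exists (x :: s') => //= y [l Hy] phiy; exists l; apply: Hs' => //.
  by rewrite functionalB phix phiy mulr0 subr0.
exists [seq u - (phi u / phi x) *: x | u <- s]; first by rewrite size_map.
move=> y [l Hy] phiy; have := span_mod_project x phiV Hy.
rewrite functionalB phiy sub0r mulNr mulfK //.
by rewrite scaleNr opprK subrK.
Qed.

End Subspaces.

(** * Tensors *)

Definition bilinear_map (K : fieldType) (U Y W : lmodType K)
  (b : U -> Y -> W) :=
  (forall y, linear (b^~ y)) /\ (forall u, linear (b u)).

Section Tensors.
Context {K : fieldType}.
Implicit Types U Y W : lmodType K.

Lemma tens0l U Y (y : Y) : tens (0 : U) y = 0.
Proof. by rewrite -(scale0r (0 : U)) tensZl scale0r. Qed.

Lemma tensor_lift_sum U Y W (b : U -> Y -> W) (s : seq (U * Y)) :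
  bilinear_map b ->
  tensor_lift b (\sum_(p <- s) tens p.1 p.2) = \sum_(p <- s) b p.1 p.2.
Proof. by case=> bl br; rewrite -pi_tensorE tensor_lift_pi. Qed.

Lemma tensor_liftP U Y W (b : U -> Y -> W) :
  bilinear_map b -> linear (tensor_lift b).
Proof. by case=> bl br; apply: tensor_lift_is_linear. Qed.

Lemma linear_sumE U W (F : U -> W) (I : Type) (r : seq I) (G : I -> U) :
  linear F -> F (\sum_(i <- r) G i) = \sum_(i <- r) F (G i).
Proof.
move=> linF; pose mF := GRing.isLinear.Build K U W _ F linF.
exact: (linear_sum (HB.pack F mF : {linear U -> W})).
Qed.

(** A left factor that depends on the others modulo [V] is replaced by a vector
    of [V], at the cost of changing the right factors of the others. *)
Lemma tens_absorb U Y (V : set U) (s : seq (U * Y)) u y :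
    span_mod V (map fst s) u ->
  exists s' v, [/\ V v, map fst s' = map fst s &
    tens u y + \sum_(p <- s) tens p.1 p.2 =
      tens v y + \sum_(p <- s') tens p.1 p.2].
Proof.
elim: s u => [|[x z] s IH] u /=; first by move=> Vu; exists [::], u.
case=> k /IH[s' [v [Vv s's E]]]; exists ((x, k *: y + z) :: s'), v.
split=> //=; first by rewrite s's.
rewrite !big_cons /= [RHS]addrCA -E tensDr tensZr -tensZl.
have -> : tens u y = tens (k *: x) y + tens (u - k *: x) y.
  by rewrite -tensDl addrC subrK.
by rewrite addrACA.
Qed.

(** Once the left factors are independent modulo [V], the functionals that are
    zero on [V] and dual to them read off the right factors, which are therefore
    in [D].  Thus slicing detects the subspace [V (x) Y + U (x) D] of the tensor
    product.  The inclusion of left factors keeps any property that they had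
    before, so that the lemma can be applied to one side after the other. *)
Lemma tensor_slice U Y (V : set U) (D : set Y) (s : seq (U * Y)) :
    subspace V -> subspace D ->
    (forall psi : {linear U -> K^o}, (forall v, V v -> psi v = 0) ->
       D (\sum_(p <- s) psi p.1 *: p.2)) ->
  exists r1 r2 : seq (U * Y),
    [/\ \sum_(p <- s) tens p.1 p.2 =
          \sum_(p <- r1) tens p.1 p.2 + \sum_(p <- r2) tens p.1 p.2,
        forall p, p \in r1 -> V p.1,
        forall p, p \in r2 -> D p.2 &
        {subset map fst r2 <= map fst s}].
Proof.
move=> subV subD; have [n] := ubnP (size s); elim: n s => // n IH [|[u y] s] /=.
  by move=> _ _; exists [::], [::]; split=> //; rewrite !big_nil addr0.
rewrite ltnS => size_s sliceD.
have [dep|indep] := pselect (span_mod V (map fst s) u).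
  have [s' [v [Vv s's E]]] := tens_absorb y dep.
  have [||r1 [r2 [E' r1V r2D r2s]]] := IH s'.
  - by rewrite -(size_map fst) s's size_map.
  - move=> psi psiV; have := sliceD psi psiV.
    have psi_bil : bilinear_map (fun (x : U) (z : Y) => psi x *: z).
      split=> [z a x x'|x a z z'].
        by rewrite linearD [psi (a *: x)]linearZ scalerDl scalerA.
      by rewrite scalerDr !scalerA mulrC.
    rewrite -!(tensor_lift_sum _ psi_bil) big_cons E /=.
    have -> : tens v y + \sum_(p <- s') tens p.1 p.2 =
        \sum_(p <- (v, y) :: s') tens p.1 p.2 by rewrite big_cons.
    by rewrite !(tensor_lift_sum _ psi_bil) big_cons /= psiV // scale0r add0r.
  exists ((v, y) :: r1), r2; split=> //.
  - by rewrite !big_cons E E' addrA.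
  - by move=> p; rewrite inE => /orP[/eqP->|/r1V].
  - by move=> x /r2s; rewrite s's inE => ->; rewrite orbT.
have [psi psiVs psiu] :=
  separating_functional (span_mod_subspace (map fst s) subV) indep.
have Dy : D y.
  have := sliceD psi (fun v Vv => psiVs v (span_mod_sub _ subV Vv)).
  rewrite big_cons /= psiu scale1r big_seq big1 ?addr0 // => p ps.
  by rewrite psiVs ?scale0r //; apply: span_mod_mem => //; apply: map_f.
have [//||r1 [r2 [E r1V r2D r2s]]] := IH s.
  move=> chi chiV.
  have := subspaceB subD (sliceD chi chiV) (subspaceZ subD (chi u) Dy).
  by rewrite big_cons /= addrC addKr.
exists r1, ((u, y) :: r2); split=> //.
- by rewrite !big_cons E addrCA.
- by move=> p; rewrite inE => /orP[/eqP->|/r2D].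
- by move=> x; rewrite !inE => /orP[->//|/r2s ->]; rewrite orbT.
Qed.

End Tensors.

(** * Convolution and the two actions of the dual algebra *)

Section Actions.
Context {K : fieldType} {C : coalgType K}.
Implicit Types (x c : C).

(** The functionals on [C] form an algebra under [conv], and [C] is a bimodule
    over it with the actions [x_1 a(x_2)] and [a(x_1) x_2].  The laws of the
    bimodule follow from the associativity of [conv], as functionals separate
    the points of [C]. *)
Definition lact (a : {linear C -> K^o}) x : C :=
  tensor_lift (fun u v : C => (a v : K) *: u) (comul x).
Definition ract x (a : {linear C -> K^o}) : C :=
  tensor_lift (fun u v : C => (a u : K) *: v) (comul x).

Lemma lact_bilinear (a : {linear C -> K^o}) :
  bilinear_map (fun u v : C => (a v : K) *: u).
Proof.
split=> [v k u u'|u k v v']; first by rewrite scalerDr !scalerA mulrC.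
by rewrite linearD [a (k *: v)]linearZ scalerDl scalerA.
Qed.

Lemma ract_bilinear (a : {linear C -> K^o}) :
  bilinear_map (fun u v : C => (a u : K) *: v).
Proof.
split=> [v k u u'|u k v v']; last by rewrite scalerDr !scalerA mulrC.
by rewrite linearD [a (k *: u)]linearZ scalerDl scalerA.
Qed.

Lemma lact_linear a : linear (lact a).
Proof.
by move=> k x y; rewrite /lact linearP; apply: tensor_liftP;
  apply: lact_bilinear.
Qed.

Lemma ract_linear a : linear (ract^~ a).
Proof.
by move=> k x y; rewrite /ract linearP; apply: tensor_liftP;
  apply: ract_bilinear.
Qed.

HB.instance Definition _ a :=
  GRing.isLinear.Build K C C _ (lact a) (lact_linear a).

Section Conv.
Variables (A : algType K).
Implicit Types f g h : {linear C -> A}.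

Lemma conv_bilinear f g : bilinear_map (fun u v : C => f u * g v).
Proof.
split=> [v k u u'|u k v v']; first by rewrite linearP mulrDl scalerAl.
by rewrite linearP mulrDr scalerAr.
Qed.

Lemma conv_linear f g : linear (conv f g).
Proof.
by move=> k x y; rewrite /conv linearP; apply: tensor_liftP;
  apply: conv_bilinear.
Qed.

HB.instance Definition _ f g :=
  GRing.isLinear.Build K C A _ (conv f g) (conv_linear f g).

Lemma convA f g h c : conv f (conv g h) c = conv (conv f g) h c.
Proof.
pose T : tensor C (tensor C C) -> A :=
  tensor_lift (fun u => fun t => f u * tensor_lift (fun v w => g v * h w) t).
have T_bil : bilinear_map
    (fun (u : C) t => f u * tensor_lift (fun v w : C => g v * h w) t).
  split=> [t k u u'|u k t t']; first by rewrite linearP mulrDl scalerAl.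
  rewrite (tensor_liftP (conv_bilinear g h)).
  by rewrite mulrDr scalerAr.
have T_lin : linear T := tensor_liftP T_bil.
transitivity (T (tensor_map idfun comul (comul c))).
  rewrite /tensor_map /tensor_lift linear_sumE //; apply: eq_bigr => p _.
  by rewrite /T (tensor_lift_tens (proj1 T_bil) (proj2 T_bil)).
rewrite -comulA.
have assoc_bil (w : C) : bilinear_map (fun u v : C => tens u (tens v w)).
  split=> [v k u u'|u k v v']; first by rewrite tensDl tensZl.
  by rewrite tensDl tensZl tensDr tensZr.
have assoc_bil2 : bilinear_map
   (fun t (w : C) => tensor_lift (fun u v : C => tens u (tens v w)) t).
  split=> [w k t t'|t k w w']; first by rewrite (tensor_liftP (assoc_bil w)).
  rewrite /tensor_lift scaler_sumr -big_split; apply: eq_bigr => p _ /=.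
  by rewrite tensDr tensZr tensDr tensZr.
rewrite /tensor_map /tensor_assoc {1}[X in T (tensor_lift _ X)]/tensor_lift.
rewrite (linear_sumE _ _ (tensor_liftP assoc_bil2)) linear_sumE //.
apply: eq_bigr => p _.
rewrite (tensor_lift_tens (proj1 assoc_bil2) (proj2 assoc_bil2)) /=.
rewrite /conv /tensor_lift linear_sumE // mulr_suml; apply: eq_bigr => q _.
rewrite /T (tensor_lift_tens (proj1 T_bil) (proj2 T_bil)).
have [gl gr] := conv_bilinear g h.
by rewrite (tensor_lift_tens gl gr) mulrA.
Qed.

End Conv.

Lemma functional_lact (psi a : {linear C -> K^o}) x :
  psi (lact a x) = conv psi a x.
Proof.
rewrite /lact /conv /tensor_lift linear_sum; apply: eq_bigr => p _.
by rewrite [LHS]linearZ /= mulrC.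
Qed.

Lemma functional_ract (psi a : {linear C -> K^o}) x :
  psi (ract x a) = conv a psi x.
Proof.
rewrite /ract /conv /tensor_lift linear_sum; apply: eq_bigr => p _.
by rewrite [LHS]linearZ.
Qed.

Lemma lact_lact a b x : lact a (lact b x) = lact (conv a b) x.
Proof.
by apply: functionals_separate => psi; rewrite !functional_lact convA.
Qed.

Lemma ract_ract a b x : ract (ract x a) b = ract x (conv a b).
Proof.
by apply: functionals_separate => psi; rewrite !functional_ract convA.
Qed.

Lemma lact_ract a b x : lact a (ract x b) = ract (lact a x) b.
Proof.
apply: functionals_separate => psi.
by rewrite functional_lact functional_ract functional_ract functional_lact
  convA.
Qed.

Lemma lact_counit x : lact counit x = x.
Proof. exact: counit_comulr. Qed.

Lemma lact_sub (a b : {linear C -> K^o}) x :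
  lact (a \- b) x = lact a x - lact b x.
Proof.
by rewrite /lact /tensor_lift -sumrB; apply: eq_bigr => p _ /=;
  rewrite scalerBl.
Qed.

Lemma lact_comb k (a b : {linear C -> K^o}) x :
  lact ((k \*: a) \+ b) x = k *: lact a x + lact b x.
Proof.
rewrite /lact /tensor_lift scaler_sumr -big_split; apply: eq_bigr => p _ /=.
by rewrite scalerDl scalerA.
Qed.

Lemma ract_sub (a : {linear C -> K^o}) x y :
  ract (x - y) a = ract x a - ract y a.
Proof. by rewrite addrC -scaleN1r ract_linear scaleN1r addrC. Qed.

End Actions.

(** * Subcoalgebras as subspaces stable under both actions *)

Section Subcoalgebras.
Context {K : fieldType} {C : coalgType K}.
Implicit Types (D E V : set C) (c e x : C).

Lemma actions_sum (a : {linear C -> K^o}) x (s : seq (C * C)) :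
    comul x = \sum_(p <- s) tens p.1 p.2 ->
  lact a x = \sum_(p <- s) (a p.2 : K) *: p.1 /\
  ract x a = \sum_(p <- s) (a p.1 : K) *: p.2.
Proof.
move=> xE; rewrite /lact /ract xE.
by split; rewrite tensor_lift_sum //;
  [apply: lact_bilinear|apply: ract_bilinear].
Qed.

(** Slicing [comul d] on the right and then on the left brings both families of
    tensor factors into [D]. *)
Lemma subcoalgebra_of_stable D : subspace D ->
    (forall (a : {linear C -> K^o}) x, D x -> D (lact a x)) ->
    (forall (a : {linear C -> K^o}) x, D x -> D (ract x a)) ->
  subcoalgebra D.
Proof.
move=> subD Dl Dr; split; first exact: (proj1 (subspaceP D) subD).
move=> d Dd; have dE := tensE (comul d).
have [|r1 [r2 [E r10 r2D _]]] :=
    tensor_slice (s := repr (comul d)) subspace_zero subD.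
  by move=> psi _; have [_ <-] := actions_sum psi dE; apply: Dr.
have zero_left (r : seq (C * C)) : (forall p, p \in r -> [set 0]%classic p.1) ->
    \sum_(p <- r) tens p.1 p.2 = 0.
  move=> r0; rewrite big_seq big1 // => p pr.
  by have -> : p.1 = 0 := r0 p pr; rewrite tens0l.
rewrite (zero_left r1) // add0r -dE in E.
set s2 := map (fun p : C * C => (p.2, p.1)) r2.
have [|t1 [t2 [F t10 t2D t2s]]] := tensor_slice (s := s2) subspace_zero subD.
  by move=> psi _; rewrite big_map; have [<- _] := actions_sum psi E; apply: Dl.
rewrite (zero_left t1) // add0r in F.
have flip_bil : bilinear_map (fun u v : C => tens v u).
  by split=> [y a u u'|u a y y']; rewrite ?tensDl ?tensDr ?tensZl ?tensZr.
exists (map (fun p => (p.2, p.1)) t2) => [p /mapP[q qt2 ->] /=|].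
  split; first exact: t2D.
  have /mapP[q' /mapP[q'' q''r2 ->] ->] := t2s _ (map_f fst qt2).
  exact: r2D.
rewrite E big_map /=.
have := congr1 (tensor_lift (fun u v : C => tens v u)) F.
by rewrite !tensor_lift_sum // big_map.
Qed.

Section OneSubcoalgebra.
Variables (E : set C) (subcE : subcoalgebra E).

Lemma subcoalgebra_subspace : subspace E.
Proof. by apply/subspaceP; case: subcE. Qed.

Lemma subcoalgebra_lact (a : {linear C -> K^o}) e : E e -> E (lact a e).
Proof.
move=> /(proj2 subcE)[s sE /(actions_sum a)[-> _]].
apply: (subspace_sum subcoalgebra_subspace) => p /sE[Ep _].
exact: subspaceZ subcoalgebra_subspace _ _ Ep.
Qed.

Lemma lact_annihilator (chi : {linear C -> K^o}) e :
  (forall x, E x -> chi x = 0) -> E e -> lact chi e = 0.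
Proof.
move=> chiE /(proj2 subcE)[s sE /(actions_sum chi)[-> _]].
by rewrite big_seq big1 // => p /sE[_ /chiE ->]; rewrite scale0r.
Qed.

Lemma annihilator_convl (a chi : {linear C -> K^o}) :
  (forall x, E x -> chi x = 0) -> forall x, E x -> conv a chi x = 0.
Proof.
by move=> chiE x Ex; rewrite -functional_lact lact_annihilator // linear0.
Qed.

Lemma annihilator_convr (a chi : {linear C -> K^o}) :
  (forall x, E x -> chi x = 0) -> forall x, E x -> conv chi a x = 0.
Proof.
by move=> chiE x Ex; rewrite -functional_lact chiE //; apply: subcoalgebra_lact.
Qed.

End OneSubcoalgebra.

(** * The coefficients of a simple quotient *)

(** The space of coefficients of the module [(C^* c + V) / V]. *)
Definition coefficients V c : set C :=
  lin_span [set x : C | exists (a psi : {linear C -> K^o}),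
    (forall v, V v -> psi v = 0) /\ x = lact a (ract c psi)]%classic.

Section Coefficients.
Variables (V : set C) (subV : subspace V).
Hypothesis lactV : forall (a : {linear C -> K^o}) x, V x -> V (lact a x).

Lemma coefficients_lact c (a : {linear C -> K^o}) x :
  coefficients V c x -> coefficients V c (lact a x).
Proof.
move=> Dx; pose W y := coefficients V c (lact a y).
apply: (Dx W) => [|_ [b [psi [psiV ->]]]].
  have subD : subspace (coefficients V c) := lin_span_subspace _.
  split=> [|k y z Wy Wz]; first by rewrite /W linear0; apply: subspace0.
  by rewrite /W linearP; apply: (proj2 subD).
by apply: sub_lin_span; exists (conv a b), psi; rewrite lact_lact.
Qed.

Lemma coefficients_ract c (a : {linear C -> K^o}) x :
  coefficients V c x -> coefficients V c (ract x a).
Proof.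
move=> Dx; pose W y := coefficients V c (ract y a).
have subD : subspace (coefficients V c) := lin_span_subspace _.
apply: (Dx W) => [|_ [b [psi [psiV ->]]]].
  split=> [|k y z Wy Wz]; last by rewrite /W ract_linear; apply: (proj2 subD).
  by rewrite /W -(subrr 0) ract_sub subrr; apply: subspace0.
apply: sub_lin_span; exists b, (conv psi a).
rewrite -lact_ract ract_ract; split=> // v Vv.
by rewrite /= -functional_lact psiV //; apply: lactV.
Qed.

Lemma coefficients_subcoalgebra c : subcoalgebra (coefficients V c).
Proof.
apply: subcoalgebra_of_stable; first exact: lin_span_subspace.
- by move=> a x; apply: coefficients_lact.
- by move=> a x; apply: coefficients_ract.
Qed.

Lemma ract_annihilator (psi : {linear C -> K^o}) v :
  (forall x, V x -> psi x = 0) -> V v -> ract v psi = 0.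
Proof.
move=> psiV Vv; apply: functionals_separate => chi.
by rewrite functional_ract -functional_lact linear0 psiV //; apply: lactV.
Qed.

Hypothesis (c : C).
Hypothesis simple_mod : forall a : {linear C -> K^o}, ~ V (lact a c) ->
  exists b : {linear C -> K^o}, V (c - lact b (lact a c)).

(** Any nonzero vector of a simple module generates it.  Hence a vector [w]
    outside [V] leads to [c], then to [chi c], back to [c] and back to [w],
    modulo [V].  The composite of these operators lies in the ideal [J] of
    functionals that are zero on [E], because [J] is two-sided and contains
    [chi]. *)
Lemma annihilator_unit E (chi a : {linear C -> K^o}) :
    subcoalgebra E -> (forall x, E x -> chi x = 0) -> ~ V (lact chi c) ->
  exists2 j : {linear C -> K^o}, forall x, E x -> j x = 0 &
    V (lact a c - lact j (lact a c)).
Proof.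
move=> subcE chiE Vchi.
have [Vw|Vw] := pselect (V (lact a c)).
  by exists chi => //; apply: subspaceB => //; apply: lactV.
have [b Vb] := simple_mod Vw; have [d Vd] := simple_mod Vchi.
(* [w = a c], [c = b w] and [c = d (chi c)] modulo [V], so that
   [a (d (chi (b w))) = w]. *)
exists (conv (conv a (conv d chi)) b).
  by apply: annihilator_convr => //; do 2 apply: annihilator_convl => //.
rewrite -!lact_lact.
have /(lactV a) := subspaceD subV Vd (lactV d (lactV chi Vb)).
by rewrite [lact chi (_ - _)]linearB [lact d (_ - _)]linearB addrA subrK
  linearB.
Qed.

(** With [J] the ideal of functionals that are zero on [E]: if [j1] and [j2]
    are in [J], [j1] fixes [y] and [j2] fixes [z - j1 z], then
    [1 - (1 - j2) (1 - j1)] lies in [J] and fixes both [y] and [z].  So it is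
    enough to fix each generator [lact a (ract c psi)], and as [psi] is zero on
    [V] it is enough for this to fix [lact a c] modulo [V]. *)
Lemma coefficients_unit E (chi : {linear C -> K^o}) x :
    subcoalgebra E -> (forall x, E x -> chi x = 0) -> ~ V (lact chi c) ->
    coefficients V c x ->
  exists2 j : {linear C -> K^o}, forall x, E x -> j x = 0 & lact j x = x.
Proof.
move=> subcE chiE Vchi Dx.
(* Quantifying over [a] makes the set of fixable vectors a submodule, as the
   passage from [z] to [z - j1 z] requires. *)
pose W y := forall a : {linear C -> K^o},
  exists2 j : {linear C -> K^o}, forall x, E x -> j x = 0 &
    lact j (lact a y) = lact a y.
suff /(_ counit) : W x by rewrite lact_counit.
apply: Dx => [|_ [b [psi [psiV ->]]] a].
  split=> [a|k y z Wy Wz a]; first by exists chi => //; rewrite !linear0.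
  have [j1 j1E fix1] := Wy a; have [j2 j2E fix2] := Wz (a \- conv j1 a).
  exists (j1 \- (conv j2 j1 \- j2)).
    move=> e Ee /=; rewrite j1E // j2E // (annihilator_convl subcE) //.
    by rewrite !subr0.
  have fixE u : lact (j1 \- (conv j2 j1 \- j2)) u =
      lact j1 u + lact j2 (u - lact j1 u).
    by rewrite !lact_sub -lact_lact [in RHS]linearB opprB.
  move: fix2; rewrite lact_sub -lact_lact => fix2.
  have -> : lact a (k *: y + z) = k *: lact a y + lact a z by rewrite linearP.
  have fix1' : lact j1 (k *: lact a y + lact a z) =
      k *: lact a y + lact j1 (lact a z) by rewrite linearP /= fix1.
  rewrite fixE fix1'.
  have -> : k *: lact a y + lact a z - (k *: lact a y + lact j1 (lact a z)) =
      lact a z - lact j1 (lact a z) by rewrite opprD addrACA subrr add0r.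
  by rewrite fix2 -addrA; congr (_ + _); rewrite addrC subrK.
rewrite lact_lact lact_ract.
have [j jE Vj] := annihilator_unit (conv a b) subcE chiE Vchi.
exists j => //; rewrite lact_ract; apply/eqP.
rewrite eq_sym -subr_eq0 -ract_sub.
by rewrite (ract_annihilator psiV Vj).
Qed.

(** The coefficients form a simple subcoalgebra unless they are zero.  Let [E]
    be a subcoalgebra of them and [J] the ideal of functionals that are zero on
    [E]; it acts by zero on [E].  If [J] moves [c] out of [V], some element of
    [J] fixes a given vector of [E], so [E] is zero.  Otherwise [J] maps [c]
    into [V], so every functional that is zero on [E] is zero on the
    coefficients, which are therefore in [E]. *)
Lemma coefficients_coradical x : coefficients V c x -> coradical C x.
Proof.
move=> Dx; have [->|x0] := eqVneq x 0; first by exists [::]; rewrite ?big_nil.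
exists [:: x]; last by rewrite big_seq1.
move=> y; rewrite inE => /eqP ->.
exists (coefficients V c) => //; split; first exact: coefficients_subcoalgebra.
  by move=> D0; move: Dx x0; rewrite D0 /= => ->; rewrite eqxx.
move=> E subcE ED.
have [[chi [chiE Vchi]]|noJ] := pselect (exists chi : {linear C -> K^o},
    (forall x, E x -> chi x = 0) /\ ~ V (lact chi c)).
  left; apply/seteqP; split=> [e Ee /=|_ ->]; last first.
    by apply: subspace0; apply: subcoalgebra_subspace.
  have [j jE <-] := coefficients_unit subcE chiE Vchi (ED _ Ee).
  by rewrite (lact_annihilator subcE).
right; apply/seteqP; split=> // z; apply; first exact: subcoalgebra_subspace.
move=> _ [a [psi [psiV ->]]].
apply: (subspace_by_functionals (subcoalgebra_subspace subcE)) => chi chiE.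
rewrite lact_ract functional_ract -functional_lact psiV // lact_lact.
apply: contrapT => Vchi; apply: noJ; exists (conv chi a); split=> //.
exact: annihilator_convr.
Qed.

End Coefficients.
End Subcoalgebras.

(** * Convolution idempotents that vanish on the coradical *)

Section Idempotent.
Context {K : fieldType} {C : coalgType K} {A : algType K}.
Variable h : {linear C -> A}.
Hypothesis h_idem : conv_idempotent h.
Hypothesis h_coradical : forall x : C, coradical C x -> h x = 0.

(** The largest submodule of [C], for the left action of the dual algebra, on
    which [h] is zero. *)
Let V : set C := fun x => forall a : {linear C -> K^o}, h (lact a x) = 0.

Let subV : subspace V.
Proof.
split=> [a|k x y Vx Vy a]; first by rewrite !linear0.
by rewrite linearP linearP Vx Vy scaler0 addr0.
Qed.

Let lactV (a : {linear C -> K^o}) x : V x -> V (lact a x).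
Proof. by move=> Vx b; rewrite lact_lact. Qed.

(** Since [h] is zero on the coefficients of [(C^* c + V) / V], the tensor
    [x_1 (x) h(x_2)] lies in [V (x) A] for [x] in [C^* c], and
    [h x = h(x_1) h(x_2)] is zero because [h] is zero on [V]. *)
Lemma idempotent_zero_on_simple (c : C) :
    (forall a : {linear C -> K^o}, ~ V (lact a c) ->
       exists b : {linear C -> K^o}, V (c - lact b (lact a c))) ->
  V c.
Proof.
move=> simple_c a; rewrite h_idem; set x := lact a c.
have hcoef (psi : {linear C -> K^o}) :
    (forall v, V v -> psi v = 0) -> h (ract x psi) = 0.
  move=> psiV; apply: h_coradical.
  apply: (coefficients_coradical subV lactV simple_c).
  by apply: sub_lin_span; exists a, psi; rewrite lact_ract.
clearbody x.
pose s := [seq (p.1, h p.2) | p <- repr (comul x)].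
have [|r1 [r2 [E r1V r20 _]]] :=
    tensor_slice (s := s) subV (@subspace_zero K A).
  move=> psi psiV; rewrite /s big_map /= -[RHS](hcoef psi psiV).
  rewrite /ract /tensor_lift linear_sum; apply: eq_bigr => p _.
  by rewrite [RHS]linearZ.
have b_bil : bilinear_map (fun (u : C) (z : A) => h u * z).
  split=> [z k u u'|u k z z']; first by rewrite linearP mulrDl scalerAl.
  by rewrite mulrDr scalerAr.
have := congr1 (tensor_lift (fun (u : C) (z : A) => h u * z)) E.
rewrite -big_cat !tensor_lift_sum // big_map big_cat /= => hE.
rewrite /conv /tensor_lift hE !big_seq !big1 ?addr0 // => p pr.
  by have -> : p.2 = 0 := r20 p pr; rewrite mulr0.
by rewrite -[p.1]lact_counit (r1V p pr) mul0r.
Qed.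

(** Induction on a bound for the dimension of [C^* c] modulo [V].  If [w] in
    [C^* c] does not generate [c] modulo [V], a functional that is zero on
    [C^* w + V] but not at [c] shows that [C^* w] has smaller dimension, so [w]
    is in [V]; hence the quotient [(C^* c + V) / V] is zero or simple. *)
Lemma idempotent_zero_of_finite (s : seq C) (c : C) :
  (forall a : {linear C -> K^o}, span_mod V s (lact a c)) -> V c.
Proof.
have [n] := ubnP (size s); elim: n s c => // n IH s c.
rewrite ltnS => size_s Hc.
apply: idempotent_zero_on_simple => a Va.
pose W : set C := fun y =>
  exists b : {linear C -> K^o}, V (y - lact b (lact a c)).
have subW : subspace W.
  split=> [|k y z [b Vb] [d Vd]].
    exists (a \- a); rewrite lact_sub subrr subr0; exact: subspace0.
  exists ((k \*: b) \+ d); rewrite lact_comb opprD addrACA -scalerBr.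
  exact: (proj2 subV).
apply: contrapT => Wc; apply: Va.
have [phi phiW phic] := separating_functional subW Wc.
have phiV v : V v -> phi v = 0.
  move=> Vv; apply: phiW; exists (a \- a).
  by rewrite lact_sub subrr subr0.
have [|| s' s's Hs'] := span_mod_hyperplane (s := s) (c := c) phiV.
- by have := Hc counit; rewrite lact_counit.
- by rewrite phic oner_eq0.
apply: (IH s'); first exact: leq_trans s's size_s.
move=> b; apply: Hs'; first by rewrite lact_lact.
by apply: phiW; exists b; rewrite subrr; apply: subspace0.
Qed.

(** The left factors of [comul c] span a space that contains [C^* c], so the
    submodule generated by any element is finite-dimensional. *)
Lemma idempotent_zero (c : C) : h c = 0.
Proof.
rewrite -[c]lact_counit.
apply: (@idempotent_zero_of_finite (map fst (repr (comul c)))).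
move=> a; rewrite /lact /tensor_lift.
apply: subspace_sum => [|p pc]; first exact: span_mod_subspace.
apply: subspaceZ; first exact: span_mod_subspace.
by apply: span_mod_mem => //; apply: map_f.
Qed.

End Idempotent.

(** Under the first part of the second condition, expanding
    [(f - g) * (f - g)] gives [f - g - g + g], so [f - g] is idempotent. *)
Theorem theorem1p8 (K : fieldType) (C : coalgType K) (A : algType K)
    (f g : {linear C -> A})
    (hf : conv_idempotent f) (hg : conv_idempotent g) :
  f =1 g <->
  ((forall c : C, conv f g c = conv g f c /\ conv g f c = g c)
   /\ (forall x : C, coradical C x -> f x = g x)).
Proof.
split=> [fg|[fgE fg0] c].
  split=> [c|x _]; last exact: fg.
  have -> : conv g f c = g c.
    by rewrite hg; apply: eq_bigr => p _; rewrite fg.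
  by split=> //; rewrite hg; apply: eq_bigr => p _; rewrite fg.
apply/eqP; rewrite -subr_eq0; apply/eqP.
apply: (@idempotent_zero K C A (f \- g)) => [x|x /fg0 /= ->]; last exact: subrr.
have [fg_gf gf_g] := fgE x.
have -> : conv (f \- g) (f \- g) x =
    (conv f f x - conv f g x) - (conv g f x - conv g g x).
  rewrite /conv /tensor_lift -!sumrB; apply: eq_bigr => p _ /=.
  by rewrite mulrBl !mulrBr.
by rewrite -hf -hg fg_gf gf_g subrr subr0.
Qed.
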